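(* Let $G$ be a finite group and let $L$ be a finite lattice equipped with an action of $G$ by lattice automorphisms. Then the reduced formal context $(J(\mathrm{Tr}(L)), M(\mathrm{Tr}(L)), \subseteq)$ of the lattice $\mathrm{Tr}(L)$ of transfer systems on $L$ has both its objects and its attributes in bijective correspondence with the set of $G$-orbits of $\mathrm{Rel}^*(L)=\{(x,y)\in L\times L : x<y\}$ (with $g\cdot(x,y)=(g\cdot x,g\cdot y)$). Explicitly: (1) the assignment $(a,b)\mapsto \lfloor a\to b\rfloor$ induces a well-defined bijection from the set of $G$-orbits of $\mathrm{Rel}^*(L)$ to $J(\mathrm{Tr}(L))$; (2) the assignment $(x,y)\mapsto \lceil x\to y\rceil^{\mathrm{rlp}}$ induces a well-defined bijection from the set of $G$-orbits of $\mathrm{Rel}^*(L)$ to $M(\mathrm{Tr}(L))$; (3) for all $a<b$ and $x<y$ in $L$, one has $\lfloor a\to b\rfloor\subseteq \lceil x\to y\rceil^{\mathrm{rlp}}$ if and only if, for all $g\in G$, $g\cdot a\not\geq x$ or $g\cdot b\not\geq y$ or $g\cdot a\geq y$.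
   Context: Let $L$ be a lattice on which a finite group $G$ acts by lattice automorphisms. A $G$-relation on $L$ is a partial order $\to$ on the set $L$ such that $x\to y$ implies $x\le y$, and $x\to y$ implies $g\cdot x\to g\cdot y$ for all $g\in G$. A transfer system on $L$ is a $G$-relation such that whenever $x\to y$ and $x'\le y$, we have $x\wedge x'\to x'$. A cotransfer system on $L$ is a $G$-relation such that whenever $x\to y$ and $x\le y'$, we have $y'\to y\vee y'$. $\mathrm{Tr}(L)$ denotes the set of transfer systems on $L$, ordered by inclusion of relations; it is a complete lattice whose meet is intersection. For $x\le y$ in $L$, $\lfloor x\to y\rfloor$ denotes the smallest transfer system containing the pair $(x,y)$, and $\lceil x\to y\rceil$ denotes the smallest cotransfer system containing the pair $(x,y)$. For a set $S$ of pairs $(c,d)$ with $c\le d$ in $L$, $S^{\mathrm{rlp}}$ denotes the set of pairs $(a,b)$ with $a\le b$ having the right lifting property, in $L$ viewed as a category, with respect to every element of $S$; that is, for every $(c,d)\in S$, if $c\le a$ and $d\le b$ then $d\le a$. For a complete lattice $P$, $J(P)$ is the set of join-irreducible elements ($p$ such that $p=\bigvee X$ implies $p\in X$, for all $X\subseteq P$) and $M(P)$ is the set of meet-irreducible elements ($p$ such that $p=\bigwedge X$ implies $p\in X$, for all $X\subseteq P$). For a finite lattice $P$, its reduced formal context is the triple $(J(P),M(P),\le)$, with objects $J(P)$, attributes $M(P)$, and relation the restriction of $\le$ to $J(P)\times M(P)$. *)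

(* Defs.v *)
From HB Require Import structures.
From mathcomp Require Import all_boot all_order all_fingroup.

Set Implicit Arguments.
Unset Strict Implicit.
Unset Printing Implicit Defensive.

Import Order.LTheory.

Local Open Scope order_scope.

Section LatticeAction.
Context (G : finGroupType) (d : Order.disp_t) (L : finLatticeType d).

Record lattice_action := LatticeAction {
  right_act :> {action G &-> L};
  right_actI : forall g, {morph right_act^~ g : x y / x `&` y};
  right_actU : forall g, {morph right_act^~ g : x y / x `|` y} }.

(* MathComp actions are right actions; [lact to g x] is the corresponding     *)
(* left action [g . x], and every left action arises in this way.             *)
Definition lact (to : lattice_action) (g : G) (x : L) : L :=
  right_act to x g^-1%g.

End LatticeAction.

Section Relations.
Context (G : finGroupType) (d : Order.disp_t) (L : finLatticeType d).
Implicit Types (to : lattice_action G L) (R S : {set L * L}) (x y : L).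

Lemma lactM to g h x : lact to (g * h)%g x = lact to g (lact to h x).
Proof. by rewrite /lact invMg actM. Qed.

Lemma lact1 to x : lact to 1%g x = x.
Proof. by rewrite /lact invg1 act1. Qed.

Lemma lactI to g : {morph lact to g : x y / x `&` y}.
Proof. exact: right_actI. Qed.

Lemma lactU to g : {morph lact to g : x y / x `|` y}.
Proof. exact: right_actU. Qed.

Lemma lact_le to g x y : x <= y -> lact to g x <= lact to g y.
Proof. by rewrite !leEmeet => /eqP xy; rewrite -lactI xy. Qed.

(* A relation [x -> y] on [L] is the set of the pairs [(x, y)].               *)
Definition G_relation to R : bool :=
  [&& [forall x, (x, x) \in R],
      [forall x, forall y, ((x, y) \in R) ==> ((y, x) \in R) ==> (x == y)],
      [forall x, forall y, forall z,
         ((x, y) \in R) ==> ((y, z) \in R) ==> ((x, z) \in R)],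
      [forall x, forall y, ((x, y) \in R) ==> (x <= y)]
    & [forall x, forall y, forall g,
         ((x, y) \in R) ==> ((lact to g x, lact to g y) \in R)]].

Definition transfer_system to R : bool :=
  G_relation to R &&
  [forall x, forall y, forall x',
     ((x, y) \in R) ==> (x' <= y) ==> ((x `&` x', x') \in R)].

Definition cotransfer_system to R : bool :=
  G_relation to R &&
  [forall x, forall y, forall y',
     ((x, y) \in R) ==> (x <= y') ==> ((y', y `|` y') \in R)].

(* These are the smallest systems containing [(x, y)] only when [x <= y]; see *)
(* [transfer_genP] and [cotransfer_genP].                                     *)
Definition transfer_gen to x y : {set L * L} :=
  \bigcap_(R : {set L * L} | transfer_system to R && ((x, y) \in R)) R.

Definition cotransfer_gen to x y : {set L * L} :=
  \bigcap_(R : {set L * L} | cotransfer_system to R && ((x, y) \in R)) R.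

Definition rlp S : {set L * L} :=
  [set p : L * L | (p.1 <= p.2) &&
     [forall q in S, (q.1 <= p.1) ==> (q.2 <= p.2) ==> (q.2 <= p.1)]].

Definition strict_pairs : {set L * L} := [set p | p.1 < p.2].

Definition pair_orbit to (p : L * L) : {set L * L} :=
  [set (lact to g p.1, lact to g p.2) | g : G].

Definition strict_orbits to : {set {set L * L}} :=
  [set pair_orbit to p | p in strict_pairs].

Definition strict_orbit to : predArgType :=
  {O : {set L * L} | O \in strict_orbits to}.

Definition le_rel : {set L * L} := [set p | p.1 <= p.2].
Definition eq_rel : {set L * L} := [set p | p.1 == p.2].

Lemma G_relationP to R :
  reflect [/\ forall x, (x, x) \in R,
              forall x y, (x, y) \in R -> (y, x) \in R -> x = y,
              forall x y z, (x, y) \in R -> (y, z) \in R -> (x, z) \in R,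
              forall x y, (x, y) \in R -> x <= y
            & forall x y g, (x, y) \in R -> (lact to g x, lact to g y) \in R]
          (G_relation to R).
Proof.
apply: (iffP and5P) => -[Rr Ra Rt Rle RG]; split.
- by move=> x; apply: (forallP Rr).
- move=> x y xy yx; apply/eqP.
  exact: (implyP (implyP (forallP (forallP Ra x) y) xy) yx).
- move=> x y z xy yz.
  exact: (implyP (implyP (forallP (forallP (forallP Rt x) y) z) xy) yz).
- by move=> x y xy; apply: (implyP (forallP (forallP Rle x) y)).
- move=> x y g xy.
  exact: (implyP (forallP (forallP (forallP RG x) y) g)).
- exact/forallP.
- apply/'forall_forallP => x y; apply/implyP => xy; apply/implyP => yx.
  by apply/eqP; apply: Ra.
- apply/'forall_'forall_forallP => x y z.
  by apply/implyP => xy; apply/implyP => yz; apply: Rt xy yz.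
- by apply/'forall_forallP => x y; apply/implyP; apply: Rle.
- by apply/'forall_'forall_forallP => x y g; apply/implyP; apply: RG.
Qed.

Lemma transfer_systemP to R :
  reflect (G_relation to R /\
           forall x y x', (x, y) \in R -> x' <= y -> (x `&` x', x') \in R)
          (transfer_system to R).
Proof.
apply: (iffP andP) => -[RG RT]; split=> //.
  move=> x y x' xy x'y.
  exact: (implyP (implyP (forallP (forallP (forallP RT x) y) x') xy) x'y).
apply/'forall_'forall_forallP => x y x'.
by apply/implyP => xy; apply/implyP; apply: RT.
Qed.

Lemma cotransfer_systemP to R :
  reflect (G_relation to R /\
           forall x y y', (x, y) \in R -> x <= y' -> (y', y `|` y') \in R)
          (cotransfer_system to R).
Proof.
apply: (iffP andP) => -[RG RT]; split=> //.
  move=> x y y' xy xy'.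
  exact: (implyP (implyP (forallP (forallP (forallP RT x) y) y') xy) xy').
apply/'forall_'forall_forallP => x y y'.
by apply/implyP => xy; apply/implyP; apply: RT.
Qed.

Lemma G_relationI to R S :
  G_relation to R -> G_relation to S -> G_relation to (R :&: S).
Proof.
move=> /G_relationP[Rr Ra Rt Rle RG] /G_relationP[Sr Sa St Sle SG].
apply/G_relationP; split=> [x|x y|x y z|x y|x y g]; rewrite !inE.
- by rewrite Rr Sr.
- by move=> /andP[xy _] /andP[yx _]; apply: Ra.
- by move=> /andP[/Rt Rxy /St Sxy] /andP[/Rxy-> /Sxy->].
- by move=> /andP[/Rle].
- by move=> /andP[/RG-> /SG->].
Qed.

Lemma transfer_systemI to R S :
  transfer_system to R -> transfer_system to S -> transfer_system to (R :&: S).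
Proof.
move=> /transfer_systemP[RG RT] /transfer_systemP[SG ST].
apply/transfer_systemP; split=> [|x y x']; first exact: G_relationI.
by rewrite !inE => /andP[/RT Rxy /ST Sxy] x'y; rewrite Rxy ?Sxy.
Qed.

Lemma cotransfer_systemI to R S :
  cotransfer_system to R -> cotransfer_system to S ->
  cotransfer_system to (R :&: S).
Proof.
move=> /cotransfer_systemP[RG RT] /cotransfer_systemP[SG ST].
apply/cotransfer_systemP; split=> [|x y y']; first exact: G_relationI.
by rewrite !inE => /andP[/RT Rxy /ST Sxy] xy'; rewrite Rxy ?Sxy.
Qed.

Lemma G_relation_le to : G_relation to le_rel.
Proof.
apply/G_relationP; split=> [x|x y|x y z|x y|x y g]; rewrite !inE //=.
- by move=> xy yx; apply/le_anti/andP.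
- exact: le_trans.
- exact: lact_le.
Qed.

Lemma transfer_system_le to : transfer_system to le_rel.
Proof.
apply/transfer_systemP; split=> [|x y x']; first exact: G_relation_le.
by rewrite !inE /= leIr.
Qed.

Lemma cotransfer_system_le to : cotransfer_system to le_rel.
Proof.
apply/cotransfer_systemP; split=> [|x y y']; first exact: G_relation_le.
by rewrite !inE /= leUr.
Qed.

Lemma transfer_system_eq to : transfer_system to eq_rel.
Proof.
apply/transfer_systemP; split=> [|x y x']; rewrite ?inE /=; last first.
  by move=> /eqP->; rewrite leEmeet meetC.
apply/G_relationP; split=> [x|x y|x y z|x y|x y g]; rewrite !inE //=.
- by move=> /eqP.
- by move=> /eqP->.
- by move=> /eqP->.
- by move=> /eqP->.
Qed.

Lemma bigcap_closed (Q : pred {set L * L}) (p : L * L) (S : {set L * L}) :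
    (forall R1 R2, Q R1 -> Q R2 -> Q (R1 :&: R2)) -> Q S -> p \in S ->
  Q (\bigcap_(R | Q R && (p \in R)) R).
Proof.
move=> QI QS pS; rewrite (bigD1 S) /= ?QS //.
pose K R := forall T, Q T -> Q (T :&: R).
suff: K (\bigcap_(R | Q R && (p \in R) && (R != S)) R) by apply.
apply: (big_rec K) => [T QT|R U /andP[/andP[QR _] _] IH T QT].
  by rewrite setIT.
by rewrite setIA; apply/IH/QI.
Qed.

Lemma transfer_genP to x y : x <= y ->
  [/\ transfer_system to (transfer_gen to x y), (x, y) \in transfer_gen to x y
    & forall R, transfer_system to R -> (x, y) \in R ->
        transfer_gen to x y \subset R].
Proof.
move=> xy; split; last 1 first.
- by move=> R RT xyR; apply: (bigcap_inf R); rewrite RT.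
- apply: (@bigcap_closed _ _ le_rel); rewrite ?inE ?transfer_system_le //.
  exact: transfer_systemI.
- by apply/bigcapP => R /andP[].
Qed.

Lemma cotransfer_genP to x y : x <= y ->
  [/\ cotransfer_system to (cotransfer_gen to x y),
      (x, y) \in cotransfer_gen to x y
    & forall R, cotransfer_system to R -> (x, y) \in R ->
        cotransfer_gen to x y \subset R].
Proof.
move=> xy; split; last 1 first.
- by move=> R RT xyR; apply: (bigcap_inf R); rewrite RT.
- apply: (@bigcap_closed _ _ le_rel); rewrite ?inE ?cotransfer_system_le //.
  exact: cotransfer_systemI.
- by apply/bigcapP => R /andP[].
Qed.

End Relations.

Section TransferLattice.
Context (G : finGroupType) (d : Order.disp_t) (L : finLatticeType d).
Context (to : lattice_action G L).

Record Tr := MkTr {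
  tr_rel :> {set L * L};
  tr_relP : transfer_system to tr_rel }.

HB.instance Definition _ := [isSub for tr_rel].
HB.instance Definition _ := [Finite of Tr by <:].

Fact Tr_display : Order.disp_t. Proof. exact: Order.Disp tt tt. Qed.

Definition Tr_le (R S : Tr) : bool := tr_rel R \subset tr_rel S.

Fact Tr_le_refl : reflexive Tr_le.
Proof. by move=> R; apply: subxx. Qed.

Fact Tr_le_anti : antisymmetric Tr_le.
Proof. by move=> R S; rewrite /Tr_le -eqEsubset => /eqP/val_inj. Qed.

Fact Tr_le_trans : transitive Tr_le.
Proof. by move=> S R T; apply: subset_trans. Qed.

HB.instance Definition _ :=
  Order.Le_isPOrder.Build Tr_display Tr Tr_le_refl Tr_le_anti Tr_le_trans.

Definition Tr_meet (R S : Tr) : Tr :=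
  MkTr (transfer_systemI (tr_relP R) (tr_relP S)).

Fact Tr_lexI (T R S : Tr) : (T <= Tr_meet R S) = (T <= R) && (T <= S).
Proof. exact: subsetI. Qed.

HB.instance Definition _ :=
  Order.POrder_isMeetSemilattice.Build Tr_display Tr Tr_lexI.

Fact Tr_le1 (R : Tr) : R <= MkTr (transfer_system_le to).
Proof.
apply/subsetP => -[x y]; rewrite inE /=.
by have /andP[/G_relationP[_ _ _ Rle _] _] := tr_relP R; apply: Rle.
Qed.

HB.instance Definition _ := Order.hasTop.Build Tr_display Tr Tr_le1.

Fact Tr_ge0 (R : Tr) : MkTr (transfer_system_eq to) <= R.
Proof.
apply/subsetP => -[x y]; rewrite inE /= => /eqP->.
by have /andP[/G_relationP[Rr _ _ _ _] _] := tr_relP R; apply: Rr.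
Qed.

HB.instance Definition _ := Order.hasBottom.Build Tr_display Tr Tr_ge0.

Definition Tr_join (R S : Tr) : Tr :=
  \meet_(T : Tr | (R <= T) && (S <= T)) T.

Fact Tr_leUx (R S T : Tr) : (Tr_join R S <= T) = (R <= T) && (S <= T).
Proof.
apply/idP/idP => [RST|RST]; last exact: meets_inf.
by apply/andP; split; apply: le_trans RST; apply/meetsP => ? /andP[].
Qed.

HB.instance Definition _ :=
  Order.POrder_isJoinSemilattice.Build Tr_display Tr Tr_leUx.

End TransferLattice.

Section FormalContext.
Context (d : Order.disp_t) (P : finTBLatticeType d).

(* [P] being finite, the subsets of [P] are the [{set P}]; taking [X] empty    *)
(* excludes the bottom (resp. top) element.                                   *)
Definition join_irreducible (p : P) : bool :=
  [forall X : {set P}, (p == \join_(x in X) x) ==> (p \in X)].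

Definition meet_irreducible (p : P) : bool :=
  [forall X : {set P}, (p == \meet_(x in X) x) ==> (p \in X)].

End FormalContext.

Record formal_context := FormalContext {
  objects : finType;
  attributes : finType;
  incidence : objects -> attributes -> bool }.

Definition reduced_context (d : Order.disp_t) (P : finTBLatticeType d) :
    formal_context :=
  @FormalContext {p : P | join_irreducible p} {p : P | meet_irreducible p}
    (fun j m => val j <= val m).

(* Main.v *)
Require Import Defs.
From mathcomp Require Import all_boot all_order all_fingroup.

(** Let [M x y] (below, [lift_rel x y]) be the set of the pairs [a <= b] against
    which every translate of [(x, y)] lifts on the left.  Lifting against a
    translation-invariant set is a Galois connection between transfer and
    cotransfer systems, so [M x y] is the right lifting class of the cotransfer
    system generated by [(x, y)] ([rlp_cotransfer_gen]).  Being itself a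
    transfer system, it contains the transfer system generated by [(a, b)] as
    soon as it contains [(a, b)]; this gives the incidence relation of the
    context.

    Both irreducibility statements come from the fact that, for [x < y], the
    pair [(x, y)] is just missing from [M x y]:

    - [M x y] misses exactly the orbit of [(x, y)] among the pairs of
      [transfer_gen to x y] ([transfer_gen_lift]).  So a transfer system
      below [transfer_gen to x y] either is all of it or lies below [M x y],
      and a join of systems of the latter kind still misses [(x, y)].
    - A transfer system above [M x y] either is [M x y] or contains [(x, y)]
      ([lift_rel_cover]), and a meet of systems of the latter kind still
      contains [(x, y)].

    Conversely, every transfer system is the join of the systems generated by
    its strict pairs, and it is the meet of the systems [M x y] above it
    ([lift_rel_separates], a finite form of the fact that a transfer system is
    the right class of a weak factorization system).  So there are no other
    irreducible elements.  Injectivity on orbits rests on the finiteness of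
    [G]: comparable elements of one orbit of [L] are equal ([lact_le_eq]). *)

Set Implicit Arguments.
Unset Strict Implicit.
Unset Printing Implicit Defensive.

Import Order.LTheory.

Local Open Scope order_scope.

Section TransferContext.

Context (G : finGroupType) (d : Order.disp_t) (L : finLatticeType d).
Context (to : lattice_action G L).
Implicit Types (a b c x y z : L) (g h : G) (p q : L * L) (T : Tr to).

Local Notation "g • x" := (lact to g x) (at level 24, right associativity).

(** * Translates *)

Lemma lactK g : cancel (lact to g) (lact to g^-1).
Proof. by move=> x; rewrite -lactM mulVg lact1. Qed.

Lemma lactKV g : cancel (lact to g^-1) (lact to g).
Proof. by move=> x; rewrite -lactM mulgV lact1. Qed.

Lemma lact_leE g x y : (g • x <= g • y) = (x <= y).
Proof.
apply/idP/idP => [|xy]; last exact: lact_le.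
by move/(lact_le to g^-1); rewrite !lactK.
Qed.

Lemma lact_leVl g x y : (g^-1 • x <= y) = (x <= g • y).
Proof. by rewrite -(lact_leE g) lactKV. Qed.

Lemma lact_leVr g x y : (x <= g^-1 • y) = (g • x <= y).
Proof. by rewrite -(lact_leE g) lactKV. Qed.

(** If [x <= k x], then [x <= k^n x] for all [n], and [k^n] may be taken to be
    the inverse of [k]. *)
Lemma lact_le_eq g h x : g • x <= h • x -> g • x = h • x.
Proof.
rewrite -lact_leVr -lactM; set k := (g^-1 * h)%g => xk.
have xkn n : x <= (k ^+ n)%g • x.
  elim: n => [|n IHn]; first by rewrite expg0 lact1.
  by rewrite expgS lactM; apply: le_trans xk _; rewrite lact_leE.
have kx : k • x = x.
  apply/le_anti; rewrite xk andbT -{2}(lactKV k x) lact_leE.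
  by rewrite invg_expg xkn.
by rewrite -{1}kx -lactM mulKVg.
Qed.

Lemma mem_pair_orbit p : p \in pair_orbit to p.
Proof.
by apply/imsetP; exists 1%g; rewrite ?inE // !lact1 -surjective_pairing.
Qed.

Lemma pair_orbit_eq p q :
  q \in pair_orbit to p -> pair_orbit to q = pair_orbit to p.
Proof.
case/imsetP=> g _ ->; apply/setP => r.
apply/imsetP/imsetP => -[h _ -> /=].
  by exists (h * g)%g; rewrite ?lactM.
by exists (h * g^-1)%g; rewrite // !lactM !lactK.
Qed.

(** * Lifting against all translates *)

Definition lifts x y a b : bool :=
  [forall g, (x <= g • a) ==> (y <= g • b) ==> (y <= g • a)].

Lemma liftsP x y a b :
  reflect (forall g, x <= g • a -> y <= g • b -> y <= g • a)
          (lifts x y a b).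
Proof.
apply: (iffP forallP) => xyab g.
  by move=> xa yb; apply: (implyP (implyP (xyab g) xa) yb).
by apply/implyP => xa; apply/implyP; apply: xyab.
Qed.

Lemma lifts_actl g x y a b : lifts (g • x) (g • y) a b = lifts x y a b.
Proof.
apply/liftsP/liftsP => H h; last first.
  by rewrite -!lact_leVr -!lactM; apply: H.
by have := H (g * h)%g; rewrite !lactM !lact_leE.
Qed.

Lemma lifts_actr g x y a b : lifts x y (g • a) (g • b) = lifts x y a b.
Proof.
apply/liftsP/liftsP => H h; last by rewrite -!lactM; apply: H.
by have := H (h * g^-1)%g; rewrite !lactM !lactK.
Qed.

Lemma lifts_self x y : x < y -> ~~ lifts x y x y.
Proof.
move=> xy; apply/negP => /liftsP/(_ 1%g); rewrite !lact1 !lexx.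
by move=> /(_ isT isT); rewrite (lt_geF xy).
Qed.

Definition lift_rel x y : {set L * L} :=
  [set p | (p.1 <= p.2) && lifts x y p.1 p.2].

Lemma transfer_system_lift_rel x y : transfer_system to (lift_rel x y).
Proof.
apply/transfer_systemP; split=> [|a b z]; last first.
  rewrite !inE /= leIr => /andP[ab /liftsP xyab] zb.
  apply/liftsP => g; rewrite lactI !lexI => /andP[xa xz] yz.
  by rewrite yz andbT; apply: xyab => //; apply: le_trans yz (lact_le _ _ zb).
apply/G_relationP; split=> [a|a b|a b c|a b|a b g]; rewrite !inE /=.
- by rewrite lexx; apply/liftsP.
- by move=> /andP[ab _] /andP[ba _]; apply/le_anti/andP.
- move=> /andP[ab /liftsP xyab] /andP[bc /liftsP xybc].
  rewrite (le_trans ab bc); apply/liftsP => g xa yc; apply: (xyab) => //.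
  by apply: xybc => //; apply: le_trans xa (lact_le _ _ ab).
- by case/andP.
- by rewrite lact_leE lifts_actr.
Qed.

Lemma cotransfer_system_colift a b :
  cotransfer_system to [set p | (p.1 <= p.2) && lifts p.1 p.2 a b].
Proof.
apply/cotransfer_systemP; split=> [|x y z]; last first.
  rewrite !inE /= leUr => /andP[xy /liftsP xyab] xz.
  apply/liftsP => g za; rewrite !leUx za => /andP[yb _]; rewrite andbT.
  by apply: xyab => //; apply: le_trans xz za.
apply/G_relationP; split=> [x|x y|x y z|x y|x y g]; rewrite !inE /=.
- by rewrite lexx; apply/liftsP.
- by move=> /andP[ab _] /andP[ba _]; apply/le_anti/andP.
- move=> /andP[xy /liftsP xyab] /andP[yz /liftsP yzab].
  rewrite (le_trans xy yz); apply/liftsP => g xa zb; apply: yzab => //.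
  by apply: xyab => //; apply: le_trans yz zb.
- by case/andP.
- by rewrite lact_leE lifts_actl.
Qed.

(** The pairs lifting against all translates of [(a, b)] form a cotransfer
    system, so they contain [cotransfer_gen to x y] once they contain
    [(x, y)]. *)
Lemma rlp_cotransfer_gen x y :
  x <= y -> rlp (cotransfer_gen to x y) = lift_rel x y.
Proof.
move=> xy; have [Csys xyC Cmin] := cotransfer_genP to xy.
have [/G_relationP[_ _ _ _ CG] _] := cotransfer_systemP _ _ Csys.
apply/setP => -[a b]; rewrite !inE /=; case: (a <= b) => //=.
apply/'forall_implyP/idP => [ab_rlp | xyab].
  apply/liftsP => g; rewrite -!lact_leVl => xa yb.
  by have /implyP/(_ xa)/implyP/(_ yb) := ab_rlp _ (CG x y g^-1%g xyC).
case=> c e /(subsetP (Cmin _ (cotransfer_system_colift a b) _)).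
rewrite !inE /= xy xyab => /(_ isT)/andP[_ /liftsP/(_ 1%g)].
by rewrite !lact1 => ceab; apply/implyP => ca; apply/implyP; apply: ceab.
Qed.

Lemma transfer_gen_sub_lift_rel a b x y : a <= b ->
  (transfer_gen to a b \subset lift_rel x y) = lifts x y a b.
Proof.
move=> ab; have [_ abT Tmin] := transfer_genP to ab.
apply/idP/idP => [/subsetP/(_ _ abT) | xyab]; first by rewrite inE => /andP[].
by apply: Tmin; [apply: transfer_system_lift_rel | rewrite inE ab].
Qed.

(** * The transfer system generated by a pair *)

(** An upper bound of [transfer_gen to a b], coarser than the exact description
    as a transitive closure but enough to control its maximal pairs. *)
Lemma transfer_system_below a b :
  transfer_system to [set p | (p.1 <= p.2) &&
    ((p.1 == p.2) || [exists g, (p.1 <= g • a) && (p.2 <= g • b)])].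
Proof.
apply/transfer_systemP; split=> [|x y z]; last first.
  rewrite !inE /= leIr => /andP[_ /orP[/eqP<- /meet_r->|]].
    by rewrite eqxx.
  case/existsP=> g /andP[xa yb] zy; apply/orP; right; apply/existsP; exists g.
  by rewrite (le_trans (leIl _ _) xa) (le_trans zy yb).
apply/G_relationP; split=> [x|x y|x y z|x y|x y g]; rewrite !inE /=.
- by rewrite lexx eqxx.
- by move=> /andP[ab _] /andP[ba _]; apply/le_anti/andP.
- move=> /andP[xy xyab] /andP[yz /orP[/eqP<-|]]; first by rewrite xy.
  case/existsP=> g /andP[ya zb]; rewrite (le_trans xy yz); apply/orP; right.
  by apply/existsP; exists g; rewrite (le_trans xy ya).
- by case/andP.
- case/andP=> xy /orP[/eqP<-|]; first by rewrite lexx eqxx.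
  case/existsP=> h /andP[xa yb]; rewrite lact_leE xy; apply/orP; right.
  by apply/existsP; exists (g * h)%g; rewrite !lactM !lact_leE xa.
Qed.

(** A nontrivial pair [(c, e)] of [transfer_gen to a b] lies below a translate
    of [(a, b)]; if lifting fails, it also lies above another translate, and
    the two translates coincide. *)
Lemma transfer_gen_lift a b c e : a <= b ->
  (c, e) \in transfer_gen to a b -> ~~ lifts a b c e ->
  (c, e) \in pair_orbit to (a, b).
Proof.
move=> ab; have [_ _ Tmin] := transfer_genP to ab.
move=> /(subsetP (Tmin _ (transfer_system_below a b) _)).
have -> : (a, b) \in [set p | (p.1 <= p.2) &&
    ((p.1 == p.2) || [exists g, (p.1 <= g • a) && (p.2 <= g • b)])].
  rewrite inE ab; apply/orP; right; apply/existsP; exists 1%g.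
  by rewrite !lact1 !lexx.
rewrite inE /= => /(_ isT)/andP[_ ce] /forallPn[g].
rewrite !negb_imply => /and3P[gc ge].
case/orP: ce => [/eqP->|/existsP[h /andP[ca eb]]]; first by rewrite ge.
rewrite -!lact_leVl in gc ge => _.
have ga := lact_le_eq (le_trans gc ca); have gb := lact_le_eq (le_trans ge eb).
apply/imsetP; exists h => //=.
by congr (_, _); apply/le_anti; rewrite ?ca ?eb -?ga -?gb.
Qed.

Lemma transfer_gen_act g x y :
  transfer_gen to (g • x) (g • y) = transfer_gen to x y.
Proof.
apply: eq_bigl => R; have [RT|//] := boolP (transfer_system to R).
have [/G_relationP[_ _ _ _ RG] _] := transfer_systemP _ _ RT.
apply/idP/idP => /= [/(RG _ _ g^-1%g)|]; first by rewrite !lactK.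
exact: RG.
Qed.

Lemma transfer_gen_inj a b x y : a < b -> x < y ->
  transfer_gen to a b = transfer_gen to x y ->
  (x, y) \in pair_orbit to (a, b).
Proof.
move=> ab xy eqT; have [_ xyT _] := transfer_genP to (ltW xy).
apply: transfer_gen_lift (ltW ab) _ _; first by rewrite eqT.
rewrite -transfer_gen_sub_lift_rel ?(ltW xy) // -eqT.
by rewrite transfer_gen_sub_lift_rel ?ltW ?lifts_self.
Qed.

(** * Join-irreducible transfer systems *)

Lemma Tr_refl T x : (x, x) \in tr_rel T.
Proof. by have /transfer_systemP[/G_relationP[]] := tr_relP T. Qed.

Lemma Tr_trans T x y z :
  (x, y) \in tr_rel T -> (y, z) \in tr_rel T -> (x, z) \in tr_rel T.
Proof. by have /transfer_systemP[/G_relationP[_ _ + _ _] _] := tr_relP T; apply. Qed.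

Lemma Tr_sub_le T x y : (x, y) \in tr_rel T -> x <= y.
Proof. by have /transfer_systemP[/G_relationP[_ _ _ + _] _] := tr_relP T; apply. Qed.

Lemma Tr_act T g x y : (x, y) \in tr_rel T -> (g • x, g • y) \in tr_rel T.
Proof. by have /transfer_systemP[/G_relationP[_ _ _ _ +] _] := tr_relP T; apply. Qed.

Lemma Tr_restrict T x y z :
  (x, y) \in tr_rel T -> z <= y -> (x `&` z, z) \in tr_rel T.
Proof. by have /transfer_systemP[_] := tr_relP T; apply. Qed.

Definition Tr_lift x y : Tr to := MkTr (transfer_system_lift_rel x y).

(** A member [S] of a family of join [T] that is not below [Tr_lift a b] has a
    pair in the orbit of [(a, b)]; then [S] contains [(a, b)], so [S = T]. *)
Lemma join_irreducible_gen T a b :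
  a < b -> tr_rel T = transfer_gen to a b -> join_irreducible T.
Proof.
move=> ab eqT; have [_ abT Tmin] := transfer_genP to (ltW ab).
apply/forallP => X; apply/implyP => /eqP defT; apply: contraT => TX.
suff: T <= Tr_lift a b.
  rewrite /Order.le /= /Tr_le eqT transfer_gen_sub_lift_rel ?ltW //.
  by rewrite (negPf (lifts_self ab)).
rewrite defT; apply/joinsP => S SX.
have ST : S <= T by rewrite defT; apply: joins_sup.
apply: contraT => /subsetPn[[c e] ceS]; rewrite inE /= (Tr_sub_le ceS) => ce.
have ceT : (c, e) \in transfer_gen to a b by rewrite -eqT (subsetP ST).
have /imsetP[g _ /= [defc defe]] := transfer_gen_lift (ltW ab) ceT ce.
have abS : (a, b) \in tr_rel S.
  by have := Tr_act g^-1 ceS; rewrite defc defe !lactK.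
have eqS : S = T.
  by apply/le_anti; rewrite ST /Order.le /= /Tr_le eqT Tmin // tr_relP.
by rewrite -eqS SX in TX.
Qed.

Lemma gen_join_irreducible T :
  join_irreducible T -> exists2 p, p.1 < p.2 & tr_rel T = transfer_gen to p.1 p.2.
Proof.
pose X := [set S : Tr to | (S <= T) &&
  [exists p : L * L, (p.1 < p.2) && (tr_rel S == transfer_gen to p.1 p.2)]].
move=> /forallP/(_ X)/implyP irrT.
suff /eqP/irrT : T = \join_(S in X) S.
  by rewrite inE => /andP[_ /existsP[p /andP[pp /eqP eqT]]]; exists p.
apply/le_anti/andP; split; last first.
  by apply/joinsP => S; rewrite inE => /andP[].
apply/subsetP => -[a b] abT; have ab := Tr_sub_le abT.
have [->|neq_ab] := eqVneq a b; first exact: Tr_refl.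
have [Ssys abS Smin] := transfer_genP to ab.
have SX : MkTr Ssys \in X.
  rewrite inE [_ <= _]Smin ?tr_relP //; apply/existsP; exists (a, b).
  by rewrite lt_neqAle neq_ab ab /=.
by apply: (subsetP (joins_sup (fun S => S) SX : MkTr Ssys <= _)).
Qed.

(** * Meet-irreducible transfer systems *)

(** If [(x, y)] fails to lift against [(a, b)] in [T], say with trivial
    translation, then [T] contains [(a `&` y, y)], where [a `&` y] is strictly
    below [y]; no translate of [y] is below [a `&` y], so [(x, a `&` y)] is
    vacuously in [lift_rel x y]. *)
Lemma lift_rel_cover T x y : x < y ->
  Tr_lift x y <= T -> T != Tr_lift x y -> (x, y) \in tr_rel T.
Proof.
move=> xy leMT; rewrite eq_le leMT andbT => /subsetPn[[a b] abT].
rewrite inE /= (Tr_sub_le abT) => /forallPn[g].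
rewrite !negb_imply => /and3P[xa yb /negP ya].
apply: Tr_trans (Tr_restrict (Tr_act g abT) yb).
apply: (subsetP leMT); rewrite inE /= lexI xa ltW //; apply/liftsP => h _.
rewrite lactI lexI => /andP[yha yhy]; case: ya.
have hy : y = h • y by rewrite -{1}(lact1 to y); apply: lact_le_eq; rewrite lact1.
by rewrite -(lact_leE h) -hy.
Qed.

(** The members of a family of meet [Tr_lift x y], if all different from it,
    all contain [(x, y)] by [lift_rel_cover], and so would their meet. *)
Lemma meet_irreducible_lift_rel x y : x < y -> meet_irreducible (Tr_lift x y).
Proof.
move=> xy; apply/forallP => X; apply/implyP => /eqP defM.
apply: contraT => MX; have [xyT _ Tmin] := transfer_genP to (ltW xy).
suff: MkTr xyT <= Tr_lift x y.
  rewrite [_ <= _]transfer_gen_sub_lift_rel ?ltW //.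
  by rewrite (negPf (lifts_self xy)).
rewrite {1}defM; apply/meetsP => S SX; apply: Tmin; first exact: tr_relP.
apply: lift_rel_cover => //; first by rewrite defM; apply: meets_inf.
by apply: contraNneq MX => <-.
Qed.

(** For [a <= b], choose a minimal [c] such that [a <= c] and [(c, b)] is in
    [T]; then [(a, c)] lifts against [T], but not against [(a, b)]. *)
Lemma lift_rel_separates T a b : a <= b -> (a, b) \notin tr_rel T ->
  exists x y, [/\ x < y, T <= Tr_lift x y & (a, b) \notin lift_rel x y].
Proof.
move=> ab abT; pose C c := (a <= c) && ((c, b) \in tr_rel T).
have Cb : C b by rewrite /C ab Tr_refl.
(* The size of the down-set of [c] is a strictly increasing measure of [c]. *)
case: (arg_minnP (fun c => #|[set z | z <= c]|) Cb) => c /andP[ac cb] cmin.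
exists a, c; split.
- rewrite lt_neqAle ac andbT; apply: contraNneq abT => ->; exact: cb.
- apply/subsetP => -[p q] pq; rewrite inE /= (Tr_sub_le pq).
  apply/liftsP => g ap cq; apply: contraT => cp.
  have /cmin : C (g • p `&` c).
    rewrite /C lexI ap ac; apply: Tr_trans cb.
    exact: Tr_restrict (Tr_act g pq) cq.
  rewrite leqNgt => /negP[]; apply: proper_card; apply/properP; split.
    by apply/subsetP => z; rewrite !inE lexI => /andP[].
  by exists c; rewrite inE ?lexI ?lexx ?andbT.
- rewrite inE ab; apply/liftsP => /(_ 1%g); rewrite !lact1 lexx /=.
  by move=> /(_ isT (Tr_sub_le cb)) ca; move: abT; rewrite (@le_anti _ _ a c) ?ac ?cb.
Qed.

Lemma lift_rel_meet_irreducible T : meet_irreducible T ->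
  exists2 p, p.1 < p.2 & T = Tr_lift p.1 p.2.
Proof.
pose X := [set S : Tr to | (T <= S) &&
  [exists p : L * L, (p.1 < p.2) && (S == Tr_lift p.1 p.2)]].
move=> /forallP/(_ X)/implyP irrT.
suff /eqP/irrT : T = \meet_(S in X) S.
  by rewrite inE => /andP[_ /existsP[p /andP[pp /eqP eqT]]]; exists p.
apply/le_anti/andP; split; first by apply/meetsP => S; rewrite inE => /andP[].
apply/subsetP => -[a b] abX; apply: contraT => abT.
have [x [y [xy TM]]] := lift_rel_separates (Tr_sub_le abX) abT.
suff XM : \meet_(S in X) S <= Tr_lift x y by rewrite (subsetP XM).
apply: meets_inf; rewrite inE TM; apply/existsP; exists (x, y).
by rewrite xy /=.
Qed.

Lemma lift_rel_act g x y : lift_rel (g • x) (g • y) = lift_rel x y.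
Proof. by apply/setP => p; rewrite !inE lifts_actl. Qed.

(** Neither [(a, b)] nor [(x, y)] is in the common set, so each is below a
    translate of the other. *)
Lemma lift_rel_inj a b x y : a < b -> x < y ->
  lift_rel a b = lift_rel x y -> (x, y) \in pair_orbit to (a, b).
Proof.
move=> ab xy eqM.
have: (x, y) \notin lift_rel a b by rewrite eqM inE /= ltW ?lifts_self.
have: (a, b) \notin lift_rel x y by rewrite -eqM inE /= ltW ?lifts_self.
rewrite !inE /= !ltW //= => /forallPn[g] + /forallPn[h].
rewrite !negb_imply => /and3P[xa yb _] /and3P[ax bY _].
have le_translate u v : u <= g • v -> v <= h • u -> u = g • v.
  move=> uv vu; apply/le_anti; rewrite uv -(lact1 to u).
  have ghu : g • v <= (g * h)%g • u by rewrite lactM lact_leE.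
  suff -> : 1%g • u = (g * h)%g • u by [].
  by apply: lact_le_eq; rewrite lact1; apply: le_trans ghu.
apply/imsetP; exists g => //=.
by rewrite -(le_translate _ _ xa ax) -(le_translate _ _ yb bY).
Qed.

(** * Bijections with orbits *)

Lemma strict_orbit_rep (O : strict_orbit to) :
  exists p, p.1 < p.2 /\ sval O = pair_orbit to p.
Proof.
by case: O => O /= /imsetP[p pp ->]; exists p; rewrite inE in pp.
Qed.

(** Describing the irreducible systems by an invariant map on strict pairs,
    injective up to translation, covers both the objects and the attributes of
    the context. *)
Lemma orbit_bijection (I : pred (Tr to)) (f : L -> L -> {set L * L}) :
    (forall g x y, f (g • x) (g • y) = f x y) ->
    (forall x y, x < y -> exists2 T, I T & tr_rel T = f x y) ->
    (forall T, I T -> exists2 p, p.1 < p.2 & tr_rel T = f p.1 p.2) ->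
    (forall a b x y, a < b -> x < y -> f a b = f x y ->
       (x, y) \in pair_orbit to (a, b)) ->
  exists F : strict_orbit to -> {T | I T},
    bijective F /\
    (forall (O : strict_orbit to) x y, (x, y) \in sval O ->
       tr_rel (sval (F O)) = f x y).
Proof.
move=> f_act f_irr irr_f f_inj.
have [O|F FE] := @fin_all_exists {O | O \in strict_orbits to} (fun _ => {T | I T})
    (fun O F => forall x y, (x, y) \in sval O -> tr_rel (sval F) = f x y).
  have [[x y] [/= xy ->]] := strict_orbit_rep O; have [T IT eqT] := f_irr _ _ xy.
  exists (exist _ T IT) => _ _ /imsetP[g _ [-> ->]] /=.
  by rewrite f_act.
exists F; split=> //.
have F_inj : injective F.
  move=> O1 O2 eqF; apply: val_inj.
  have [[a b] [/= ab defO1]] := strict_orbit_rep O1.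
  have [[x y] [/= xy defO2]] := strict_orbit_rep O2.
  rewrite [val O1]defO1 [val O2]defO2; apply/esym/pair_orbit_eq/f_inj => //.
  rewrite -(FE O1) -?(FE O2) ?eqF ?defO1 ?defO2 //; exact: mem_pair_orbit.
have [S|H HK] := @fin_all_exists {T | I T} (fun _ => strict_orbit to)
    (fun S O => F O = S).
  have [[x y] /= xy eqT] := irr_f _ (svalP S).
  have Oxy : pair_orbit to (x, y) \in strict_orbits to.
    by apply: imset_f; rewrite inE.
  exists (exist (fun O => O \in strict_orbits to) _ Oxy); apply/val_inj/val_inj.
  by rewrite /= eqT; apply: FE; apply: mem_pair_orbit.
by exists H => // O; apply: F_inj; rewrite HK.
Qed.

End TransferContext.

Theorem theorem1 (G : finGroupType) (d : Order.disp_t) (L : finLatticeType d)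
    (to : lattice_action G L) :
  [/\ exists J : strict_orbit to -> objects (reduced_context (Tr to)),
        bijective J /\
        (forall (O : strict_orbit to) (a b : L), (a, b) \in sval O ->
           tr_rel (sval (J O)) = transfer_gen to a b),
      exists M : strict_orbit to -> attributes (reduced_context (Tr to)),
        bijective M /\
        (forall (O : strict_orbit to) (x y : L), (x, y) \in sval O ->
           tr_rel (sval (M O)) = rlp (cotransfer_gen to x y))
    & forall a b x y : L, a < b -> x < y ->
        (transfer_gen to a b \subset rlp (cotransfer_gen to x y)) <->
        (forall g : G, ~ (x <= lact to g a) \/ ~ (y <= lact to g b) \/
                       y <= lact to g a)].
Proof.
split.
- apply: orbit_bijection.
  + exact: transfer_gen_act.
  + move=> a b ab; have [Tsys _ _] := transfer_genP to (ltW ab).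
    by exists (MkTr Tsys) => //; apply: join_irreducible_gen ab _.
  + exact: gen_join_irreducible.
  + exact: transfer_gen_inj.
- have [|x y xy|T||M [Mbij ME]] :=
    @orbit_bijection _ _ _ to (@meet_irreducible _ (Tr to)) (lift_rel to).
  + exact: lift_rel_act.
  + by exists (Tr_lift to x y) => //; apply: meet_irreducible_lift_rel.
  + by case/lift_rel_meet_irreducible=> p pp ->; exists p.
  + exact: lift_rel_inj.
  exists M; split=> // O x y xyO; rewrite (ME O x y) // rlp_cotransfer_gen //.
  have [[u v] [/= uv defO]] := strict_orbit_rep O.
  by move: xyO; rewrite defO => /imsetP[g _ [-> ->]]; rewrite lact_leE ltW.
- move=> a b x y /ltW ab /ltW xy.
  rewrite rlp_cotransfer_gen // transfer_gen_sub_lift_rel //.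
  split=> [/liftsP H g | H]; last by apply/liftsP => g xa yb; case: (H g) => [|[]].
  have [xa|] := boolP (x <= lact to g a); last by left; apply/negP.
  have [yb|] := boolP (y <= lact to g b); last by right; left; apply/negP.
  by right; right; apply: H.
Qed.
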